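(* Assume the standing and strengthened assumptions in the context, and let $f\in AC^1(I)$. (I) There exists a real number $a_1$ with $\lim_{x\to x_0}f_1^*(x)=a_1$ if and only if $\int_T^{x_0}\phi_2(t)W(t)^{-1}L[f(t)]\,dt$ converges; in that case $$f_1^*(x)=a_1+\int_x^{x_0}\phi_2(t)W(t)^{-1}L[f(t)]\,dt,\qquad x\in[T,x_0).$$ Moreover, the pair of conditions ''$\lim_{x\to x_0}f_1^*(x)=a_1$ for some real $a_1$ and $\int_T^{x_0}(\phi_1(t)/\phi_2(t))'[f_1^*(t)-a_1]\,dt$ converges'' holds if and only if the iterated improper integral $$\int_T^{x_0}\Big(\frac{\phi_1(t)}{\phi_2(t)}\Big)'dt\int_t^{x_0}\phi_2(s)W(s)^{-1}L[f(s)]\,ds$$ converges (i.e. the inner integral converges for every $t$ and the outer one converges). (II) There exists a real number $a_2$ with $\lim_{x\to x_0}f_2^*(x)=a_2$ if and only if $\int_T^{x_0}\phi_1(t)W(t)^{-1}L[f(t)]\,dt$ converges; in that case $$f_2^*(x)=a_2-\int_x^{x_0}\phi_1(t)W(t)^{-1}L[f(t)]\,dt,\qquad x\in[T,x_0).$$ There exists a real number $\gamma$ with $\lim_{x\to x_0}F^*(x)=\gamma$ if and only if $\int_T^{x_0}\Phi(t)W(t)^{-1}L[f(t)]\,dt$ converges; in that case $$F^*(x)=\gamma-\int_x^{x_0}\Phi(t)W(t)^{-1}L[f(t)]\,dt,\qquad x\in[T,x_0).$$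
   Context: Let $x_0\in\mathbb{R}\cup\{+\infty\}$, $T\in\mathbb{R}$ with $T<x_0$, and $I:=[T,x_0)$. Limits ''as $x\to x_0$'' are taken for $x\in I$. For differentiable $g,h$ put $W(g,h;x):=g(x)h'(x)-g'(x)h(x)$. Standing assumptions: $\phi_1,\phi_2\in C^1(I)$; $\phi_2(x)=o(\phi_1(x))$ as $x\to x_0$; $\phi_1(x)\neq0$, $\phi_2(x)\neq0$ for all $x\in I$; $W(x):=W(\phi_1,\phi_2;x)\neq0$ for all $x\in I$. Strengthened assumption: $\phi_1,\phi_2\in AC^1(I)$, where $AC^1(I)$ is the set of $C^1$ functions on $I$ whose derivative is absolutely continuous on every compact subinterval of $I$. $L$ denotes the unique operator $L[u]=u''+a_1(x)u'+a_2(x)u$ with $a_1,a_2$ locally Lebesgue-integrable on $I$ whose kernel is $\mathrm{span}(\phi_1,\phi_2)$; equivalently $L[u]=\frac{W(x)}{\phi_1(x)}\Big[\frac{\phi_1(x)^2}{W(x)}\Big(\frac{u}{\phi_1}\Big)'\Big]'$ for $u\in AC^1(I)$ (defined a.e.). For $f\in AC^1(I)$ define $f_1^*(t):=W(f,\phi_2;t)/W(t)$, $f_2^*(t):=-W(f,\phi_1;t)/W(t)$, $\Phi(x):=\phi_2(T)\phi_1(x)-\phi_1(T)\phi_2(x)$, $F^*(t):=\phi_1(T)f_1^*(t)+\phi_2(T)f_2^*(t)=W(\Phi,f;t)/W(t)$. *)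

(* Defs.v *)
From mathcomp Require Import all_boot all_order all_algebra.
From mathcomp Require Import all_classical all_reals all_analysis.
Import Order.TTheory GRing.Theory Num.Theory numFieldNormedType.Exports.

Set Implicit Arguments.
Unset Strict Implicit.
Unset Printing Implicit Defensive.

Local Open Scope classical_set_scope.
Local Open Scope ring_scope.

Section Defs.
Context {R : realType}.

Definition leb := @completed_lebesgue_measure R.

Definition Iset (T : R) (x0 : \bar R) : set R :=
  [set x | T <= x /\ (x%:E < x0)%E].

(* the filter "x -> x0 with x in I": left limit at a finite x0, +oo otherwise
   (x0 = -oo never occurs since T < x0) *)
Definition to_x0 (x0 : \bar R) : set_system R :=
  match x0 with
  | EFin r => at_left r
  | _ => pinfty_nbhs R
  end.

(* df is the derivative of f on the set A (relative to A; one-sided at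
   endpoints of an interval) *)
Definition deriv_on (A : set R) (f df : R -> R) : Prop :=
  forall x, A x ->
    (fun h => h^-1 * (f (x + h) - f x)) @ within (fun h => A (x + h)) (dnbhs (0:R))
      --> df x.

(* absolute continuity of g on [a, b] (classical epsilon-delta definition,
   the disjoint subintervals being listed in increasing order) *)
Definition abs_cont (a b : R) (g : R -> R) : Prop :=
  forall e : R, 0 < e -> exists2 d : R, 0 < d &
    forall (n : nat) (u v : nat -> R),
      (forall k, (k < n)%N -> a <= u k /\ u k <= v k /\ v k <= b) ->
      (forall k, (k.+1 < n)%N -> v k <= u k.+1) ->
      \sum_(k < n) (v k - u k) < d ->
      \sum_(k < n) `|g (v k) - g (u k)| < e.

Definition C1_on (T : R) (x0 : \bar R) (f df : R -> R) : Prop :=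
  deriv_on (Iset T x0) f df /\ {within Iset T x0, continuous df}.

Definition AC1_on (T : R) (x0 : \bar R) (f df : R -> R) : Prop :=
  C1_on T x0 f df /\
  forall a b, T <= a -> (b%:E < x0)%E -> abs_cont a b df.

Definition Wr (g dg h dh : R -> R) (x : R) : R := g x * dh x - dg x * h x.

(* The operator L with kernel span(phi1, phi2):
   L[u] = det(u, phi1, phi2 ; u', phi1', phi2' ; u'', phi1'', phi2'') / W
        = u'' + a1 u' + a2 u  (defined a.e.; second derivatives via derive1) *)
Definition Lop (phi1 dphi1 phi2 dphi2 u du : R -> R) (x : R) : R :=
  let W := Wr phi1 dphi1 phi2 dphi2 x in
  let dd1 := derive1 dphi1 x in
  let dd2 := derive1 dphi2 x in
  let a1 := - (phi1 x * dd2 - dd1 * phi2 x) / W in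
  let a2 := (dphi1 x * dd2 - dd1 * dphi2 x) / W in
  derive1 du x + a1 * du x + a2 * u x.

Definition loc_int (x : R) (x0 : \bar R) (g : R -> R) : Prop :=
  forall b, x <= b -> (b%:E < x0)%E -> leb.-integrable `[x, b] (EFin \o g).

Definition improper_to (x : R) (x0 : \bar R) (g : R -> R) (l : R) : Prop :=
  loc_int x x0 g /\
  (fun b => Rintegral leb `[x, b] g) @ to_x0 x0 --> l.

Definition improper_cvg (x : R) (x0 : \bar R) (g : R -> R) : Prop :=
  exists l : R, improper_to x x0 g l.

End Defs.

(* Main.v *)
(* Each of f1*, f2*, F* is, up to sign, a quotient h of Wronskians of AC^1
   functions, hence absolutely continuous on compact subintervals, and Cramer's
   rule gives h' = (psi / W) L[f] wherever phi1', phi2', f' are all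
   differentiable. So everything reduces to the fundamental theorem of calculus
   for absolutely continuous functions: then the integral over [x, b] is
   h(b) - h(x), and one lets b -> x0.

   That theorem is obtained as follows. If F is absolutely continuous then so is
   its total variation T, and F = T - (T - F) with T and T - F nondecreasing.
   The Stieltjes measure of a nondecreasing absolutely continuous function is
   dominated by Lebesgue measure, so Radon-Nikodym provides a density, and
   Lebesgue differentiation identifies that density with the derivative. *)

Require Import Defs.
From HB Require Import structures.
From mathcomp Require Import all_boot all_order all_algebra.
From mathcomp Require Import all_classical all_reals all_analysis.
From mathcomp Require Import measurable_realfun ring lra.
Import Order.TTheory GRing.Theory Num.Theory numFieldNormedType.Exports.
Set Implicit Arguments.
Unset Strict Implicit.
Unset Printing Implicit Defensive.
Local Open Scope classical_set_scope.
Local Open Scope ring_scope.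

(** The real line with the Caratheodory sigma-algebra, on which the complete measure [leb] lives;
    [measurableTypeR R] carries the Borel sets instead. *)
Local Notation lebT R := (caratheodory_type (wlength (@idfun R))^*%mu).

(** * Absolute continuity and variation *)

Section Chains.
Context {R : realType}.
Implicit Types (a b c d lo hi x y : R) (s : seq (R * R)) (F G H : R -> R).

(* A chain lists the intervals [u_k, v_k] of [abs_cont], in increasing order. *)
Fixpoint chain lo hi s : bool :=
  if s is p :: s' then [&& lo <= p.1, p.1 <= p.2 & chain p.2 hi s']
  else lo <= hi.

Definition len s : R := \sum_(p <- s) (p.2 - p.1).
Definition var F s : R := \sum_(p <- s) `|F p.2 - F p.1|.

(** Lists of intervals, unlike indexed families, can be concatenated, refined and handled by
    induction. *)
Definition ac_on a b F := forall e : R, 0 < e -> exists2 d : R, 0 < d &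
  forall s, chain a b s -> len s < d -> var F s < e.

Lemma chain_le lo hi s : chain lo hi s -> lo <= hi.
Proof.
elim: s lo => //= p s IH lo /and3P[h1 h2 /IH h3].
exact: le_trans (le_trans h1 h2) h3.
Qed.

Lemma chain_mem lo hi s p : chain lo hi s -> p \in s ->
  [/\ lo <= p.1, p.1 <= p.2 & p.2 <= hi].
Proof.
elim: s lo => //= q s IH lo /and3P[h1 h2 h3]; rewrite inE.
move=> /predU1P[->|/(IH _ h3)[k1 k2 k3]].
  by split => //; exact: chain_le h3.
by split => //; apply: le_trans k1; exact: le_trans h2.
Qed.

Lemma chain_widen lo hi lo' hi' s : lo' <= lo -> hi <= hi' ->
  chain lo hi s -> chain lo' hi' s.
Proof.
move=> l h; elim: s lo lo' l => [|p s IH] lo lo' l /=.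
  by move=> lh; rewrite (le_trans l)// (le_trans lh).
by move=> /and3P[h1 h2 h3]; rewrite (le_trans l h1) h2 /= (IH p.2).
Qed.

Lemma chain_cat lo mi hi s1 s2 : chain lo mi s1 -> chain mi hi s2 ->
  chain lo hi (s1 ++ s2).
Proof.
move=> + h2; elim: s1 lo => [|p s IH] lo /=.
  by move=> lm; exact: chain_widen h2.
by move=> /and3P[-> -> /IH ->].
Qed.

Lemma len_le lo hi s : chain lo hi s -> len s <= hi - lo.
Proof.
elim: s lo => [|p s IH] lo /=; first by rewrite /len big_nil subr_ge0.
by move=> /and3P[h1 h2 /IH]; rewrite /len big_cons; lra.
Qed.

Lemma var_cat F s1 s2 : var F (s1 ++ s2) = var F s1 + var F s2.
Proof. by rewrite /var big_cat. Qed.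

Lemma len_cat s1 s2 : len (s1 ++ s2) = len s1 + len s2.
Proof. by rewrite /len big_cat. Qed.

(** The default pair [(hi, hi)] keeps the last inequality true at the final index, where [k.+1] lies
    outside the list. *)
Lemma chain_nth lo hi s k : chain lo hi s -> (k < size s)%N ->
  [/\ lo <= (nth (hi, hi) s k).1, (nth (hi, hi) s k).1 <= (nth (hi, hi) s k).2,
    (nth (hi, hi) s k).2 <= hi &
    (nth (hi, hi) s k).2 <= (nth (hi, hi) s k.+1).1].
Proof.
move=> cs ks; have [h1 h2 h3] := chain_mem cs (mem_nth (hi, hi) ks).
split => //.
elim: s lo k cs ks {h1 h2 h3} => //= p s IH lo [|k] /and3P[h1 h2 h3] ks /=.
  by case: s h3 {IH ks} => //= q s /and3P[].
exact: (IH p.2).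
Qed.

Lemma abs_cont_ac_on a b F : abs_cont a b F -> ac_on a b F.
Proof.
move=> acF e /acF[d d0 h]; exists d => // s cs ls.
rewrite /var (big_nth (b, b)) big_mkord.
apply: (h (size s) (fun k => (nth (b, b) s k).1) (fun k => (nth (b, b) s k).2)).
- by move=> k /(chain_nth cs)[].
- by move=> k /ltnW/(chain_nth cs)[].
- by move: ls; rewrite /len (big_nth (b, b)) big_mkord.
Qed.

(** Summing the bound on increments over a chain bounds the variation of [H] by those of [F] and
    [G]. The closure properties of absolute continuity all reduce to such a bound. *)
Lemma ac_on_dominated a b F G H M :
  (forall x y, a <= x <= b -> a <= y <= b ->
     `|H y - H x| <= M * (`|F y - F x| + `|G y - G x|)) ->
  ac_on a b F -> ac_on a b G -> ac_on a b H.
Proof.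
(* The maximum with 1 gives a positive factor to divide by, as [M] may be zero or negative. *)
move=> HM aF aG e e0; pose M' := Num.max M 1.
have M0 : 0 < M' by rewrite lt_max ltr01 orbT.
have e0' : 0 < e / (M' * 2) by rewrite divr_gt0// mulr_gt0.
have [d1 d10 h1] := aF _ e0'; have [d2 d20 h2] := aG _ e0'.
exists (Num.min d1 d2); first by rewrite lt_min d10.
move=> s cs; rewrite lt_min => /andP[/(h1 _ cs) k1 /(h2 _ cs) k2].
apply: (@le_lt_trans _ _ (M' * (var F s + var G s))).
  rewrite /var -big_split/= mulr_sumr big_seq [leRHS]big_seq.
  apply: ler_sum => p /(chain_mem cs)[p1 p2 p3].
  apply: (le_trans (HM _ _ _ _)).
  - by rewrite p1 (le_trans p2).
  - by rewrite p3 (le_trans p1).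
  by rewrite ler_wpM2r// ?addr_ge0// le_max lexx.
have -> : e = M' * (e / (M' * 2) + e / (M' * 2)) by field; rewrite gt_eqF.
by rewrite ltr_pM2l// ltrD.
Qed.

Lemma ac_on_sub a b c d F : a <= c -> d <= b -> ac_on a b F -> ac_on c d F.
Proof.
move=> ac db aF e /aF[e' e'0 h]; exists e' => // s cs.
by apply: h; exact: chain_widen cs.
Qed.

Lemma ac_on_id a b : ac_on a b id.
Proof.
move=> e e0; exists e => // s cs; apply: le_lt_trans.
rewrite /var /len big_seq [leRHS]big_seq ler_sum// => p /(chain_mem cs)[_ pp _].
by rewrite ger0_norm// subr_ge0.
Qed.

Lemma ac_onB a b F G : ac_on a b F -> ac_on a b G -> ac_on a b (fun x => F x - G x).
Proof.
apply: (@ac_on_dominated a b _ _ _ 1) => x y _ _; rewrite mul1r.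
have -> : F y - G y - (F x - G x) = (F y - F x) - (G y - G x) by ring.
exact: ler_normB.
Qed.

Definition clamp c d x : R := Num.max c (Num.min d x).

Definition clamps c d s := [seq (clamp c d p.1, clamp c d p.2) | p <- s].

Lemma clamp_nd c d x y : x <= y -> clamp c d x <= clamp c d y.
Proof. by move=> xy; apply: le_max2 => //; apply: le_min2. Qed.

Lemma clamp_ge c d x : c <= clamp c d x.
Proof. by rewrite le_max lexx. Qed.

Lemma clamp_le c d x : c <= d -> clamp c d x <= d.
Proof. by move=> cd; rewrite ge_max cd ge_min lexx. Qed.

Lemma clamp_id c d x : c <= x <= d -> clamp c d x = x.
Proof. by move=> /andP[cx xd]; rewrite /clamp min_r// max_r. Qed.

Lemma chain_clamps c d lo hi s : c <= d -> chain lo hi s ->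
  chain c d (clamps c d s).
Proof.
move=> cd cs; apply: (@chain_widen (clamp c d lo) (clamp c d hi));
  rewrite ?clamp_ge ?clamp_le//.
elim: s lo cs => [|p s IH] lo /=; first exact: clamp_nd.
by move=> /and3P[h1 h2 /IH ->]; rewrite !clamp_nd.
Qed.

(* Cutting an interval at m through [clamp] needs no case distinction on where m
   lies, which makes the variation subadditive termwise. *)
Lemma clamp_split F c m d x : c <= m <= d ->
  F (clamp c d x) = F (clamp c m x) + F (clamp m d x) - F m.
Proof.
move=> /andP[cm md]; rewrite /clamp.
case: (boolP (x <= m)) => [xm|]; last rewrite -ltNge => mx.
  rewrite (min_r xm) (min_r (le_trans xm md)) (@max_l _ _ m)// addrK//.
have mdx : m <= Num.min d x by rewrite le_min md ltW.
rewrite (min_l (ltW mx)) (max_r cm) (max_r mdx) (max_r (le_trans cm mdx)).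
by ring.
Qed.

Lemma var_clamps_split F c m d s : c <= m <= d ->
  var F (clamps c d s) <= var F (clamps c m s) + var F (clamps m d s).
Proof.
move=> cmd; rewrite /var !big_map -big_split/=; apply: ler_sum => p _.
rewrite !(clamp_split F _ cmd); apply: le_trans (ler_normD _ _).
by rewrite le_eqVlt; apply/orP; left; apply/eqP; congr `| _ |; ring.
Qed.

Lemma clamps_id c d s : chain c d s -> clamps c d s = s.
Proof.
move=> cs; rewrite /clamps -[RHS]map_id; apply/eq_in_map.
move=> -[u v] /(chain_mem cs)[/= h1 h2 h3].
by rewrite !clamp_id//= ?h1 ?h3 ?(le_trans h1)// (le_trans h2).
Qed.

(** Let [d] answer [e = 1] and cut [[a, b]] into [m] pieces shorter than [d]. Each piece contributes
    at most 1 to the variation of any chain, so [m] is a bound. *)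
Lemma ac_on_var_bounded a b F : a <= b -> ac_on a b F ->
  exists M, forall s, chain a b s -> var F s <= M.
Proof.
move=> ab /(_ 1 ltr01)[d d0 h].
pose m := Num.bound ((b - a) / d).
have bad : 0 <= (b - a) / d by rewrite divr_ge0 ?subr_ge0// ltW.
have bam : (b - a) / d < m%:R by exact: archi_boundP.
have m0 : 0 < m%:R :> R by exact: le_lt_trans bam.
pose p (j : nat) := a + j%:R * ((b - a) / m%:R).
have st : 0 <= (b - a) / m%:R by rewrite divr_ge0 ?subr_ge0// ltW.
exists m%:R => s cs.
(* Induction on the number of pieces: for [j = 0] clamping is constant, and each further cut costs
   at most 1. *)
have H j : (j <= m)%N -> var F (clamps a (p j) s) <= j%:R.
  elim: j => [_|j IH jm].
    rewrite /p mul0r addr0 /var big_map big1// => q _ /=.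
    have e x : clamp a a x = a by apply/le_anti; rewrite clamp_le//= clamp_ge.
    by rewrite !e subrr normr0.
  have pj : p j.+1 = p j + (b - a) / m%:R by rewrite /p -natr1; ring.
  have apj : a <= p j by rewrite lerDl mulr_ge0.
  have pm : p j.+1 <= b.
    rewrite /p -lerBrDl mulrA ler_pdivrMr// mulrC ler_wpM2l ?subr_ge0//.
    by rewrite ler_nat.
  have pjj : p j <= p j.+1 by rewrite pj lerDl.
  apply: le_trans (var_clamps_split F s (_ : a <= p j <= p j.+1)) _.
    by rewrite apj.
  rewrite -natr1 lerD ?IH ?(ltnW jm)//.
  have cj := chain_clamps pjj cs.
  apply/ltW/h; first exact: chain_widen cj.
  apply: le_lt_trans (len_le cj) _; rewrite pj addrAC subrr add0r.
  by rewrite ltr_pdivrMr// mulrC -ltr_pdivrMr.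
have := H m (leqnn m); rewrite /p mulrC divfK ?gt_eqF// addrC subrK clamps_id//.
Qed.

End Chains.

Section Variation.
Context {R : realType} (a b : R) (F : R -> R).
Hypothesis ab : a <= b.
Hypothesis aF : ac_on a b F.

(** Chains may leave gaps, but filling a gap never lowers the variation, so the supremum is the
    usual total variation on [[a, x]]. *)
Definition vars x := [set v | exists2 s, chain a x s & v = var F s].
Definition totvar x : R := sup (vars x).

Lemma vars_sup x : a <= x <= b -> has_sup (vars x).
Proof.
move=> /andP[ax xb]; split; first by exists (var F [::]), [::].
have [M hM] := ac_on_var_bounded ab aF.
by exists M => _ [s cs ->]; apply: hM; exact: chain_widen cs.
Qed.

(** Appending [s] to any chain of [[a, x]] gives a chain of [[a, y]]. *)
Lemma totvar_ge x y s : a <= x -> y <= b -> chain x y s ->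
  totvar x + var F s <= totvar y.
Proof.
move=> ax yb cs; have xy := chain_le cs.
rewrite -lerBrDr; apply: ge_sup.
  by have [] := @vars_sup x; rewrite ?ax ?(le_trans xy).
move=> _ [s0 cs0 ->]; rewrite lerBrDr -var_cat; apply: ub_le_sup.
  by have [] := @vars_sup y; rewrite ?yb ?(le_trans ax).
by exists (s0 ++ s) => //; exact: chain_cat cs.
Qed.

(** Take a nearly optimal chain of [[a, y]] and cut it at [x]: the part in [[a, x]] has variation at
    most [totvar x], so the part in [[x, y]] is nearly optimal too. *)
Lemma totvar_approx x y e : a <= x -> x <= y -> y <= b -> 0 < e ->
  exists2 s, chain x y s & totvar y - totvar x <= var F s + e.
Proof.
move=> ax xy yb e0; have ay := le_trans ax xy.
have hy : has_sup (vars y) by apply: vars_sup; rewrite ay.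
have [_ [s cs ->] es] := sup_adherent e0 hy.
exists (clamps x y s); first exact: chain_clamps cs.
have := var_clamps_split F s (_ : a <= x <= y); rewrite ax xy => /(_ isT).
rewrite (clamps_id cs).
have := totvar_ge (lexx a) (le_trans xy yb) (chain_clamps ax cs).
have t0 : 0 <= totvar a.
  apply: ub_le_sup; first by have [] := @vars_sup a; rewrite ?lexx.
  by exists [::] => //=; rewrite /var big_nil.
by move: es; rewrite -/(totvar y); lra.
Qed.

(** Replace each interval of the chain by a nearly optimal chain inside it. The refined chain is no
    longer than the original, so absolute continuity of [F] controls its variation. *)
Lemma ac_on_totvar : ac_on a b totvar.
Proof.
move=> e e0; have e20 : 0 < e / 2 by rewrite divr_gt0.
have [d d0 h] := aF e20; exists d => // s cs ls.
have K lo s' h' : a <= lo -> 0 < h' -> chain lo b s' ->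
    exists t, [/\ chain lo b t, len t <= len s' &
      var totvar s' <= var F t + (size s')%:R * h'].
  move=> + h'0; elim: s' lo => [|p s' IH] lo alo /=.
    by move=> lb; exists [::]; rewrite /var /= !big_nil mul0r addr0.
  move=> /and3P[p1 p2 cs'].
  have p2b := chain_le cs'.
  have ap1 := le_trans alo p1.
  have [t [t1 t2 t3]] := IH _ (le_trans ap1 p2) cs'.
  have [s0 cs0 es0] := totvar_approx ap1 p2 p2b h'0.
  exists (s0 ++ t); split.
  - by apply: chain_cat t1; exact: chain_widen cs0.
  - by rewrite len_cat [leRHS]/len big_cons lerD// len_le.
  - rewrite var_cat [leLHS]/var big_cons -/(var _ _) -natr1.
    have := totvar_ge ap1 p2b (_ : chain p.1 p.2 [::]).
    rewrite /= p2 => /(_ isT).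
    rewrite /var big_nil addr0 => tt.
    by rewrite ger0_norm ?subr_ge0//; move: t3 es0; rewrite /var; lra.
(* The error allowed on each interval, so that all errors together stay within [e / 2]; the
   successor covers the empty chain. *)
have n0 : 0 < e / 2 / (size s).+1%:R by rewrite divr_gt0.
have [t [t1 t2 t3]] := K _ _ _ (lexx a) n0 cs.
have k := h t t1 (le_lt_trans t2 ls).
apply: le_lt_trans t3 _; rewrite [ltRHS]splitr ltr_leD//.
by rewrite mulrCA ler_piMr ?(ltW e20)// ler_pdivrMr// mul1r ler_nat.
Qed.

(** The chain with the single interval [[x, y]] shows that [totvar] grows by at least the absolute
    increment of [F]; both claims follow. *)
Lemma totvar_nd x y : a <= x -> x <= y -> y <= b ->
  totvar x <= totvar y /\ totvar x - F x <= totvar y - F y.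
Proof.
move=> ax xy yb.
have := totvar_ge ax yb (_ : chain x y [:: (x, y)]); rewrite /= lexx xy /= lexx.
move=> /(_ isT); rewrite /var big_seq1 /= => h; split; move: h.
  by apply: le_trans; rewrite lerDl.
have := ler_norm (F y - F x); lra.
Qed.

End Variation.

(** * Density of a monotone absolutely continuous function *)

Section ChainMeasure.
Context {R : realType}.
Implicit Types (G : cumulative R R) (s : seq (R * R)).

(** Half-open intervals keep adjacent members of a chain disjoint and match the Stieltjes mass of
    []u, v]]. *)
Definition chain_set s : set (measurableTypeR R) :=
  [set x | exists2 p, p \in s & p.1 < x <= p.2].

Lemma lebesgue_stieltjes_itvoc G (x y : R) : x <= y ->
  lebesgue_stieltjes_measure G `]x, y] = (G y - G x)%:E.
Proof.
move=> xy; rewrite /lebesgue_stieltjes_measure /measure_extension.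
rewrite measurable_mu_extE/=; last by exists (x, y).
by rewrite wlength_itv_bnd.
Qed.

Lemma chain_set_cons p s : chain_set (p :: s) = `]p.1, p.2] `|` chain_set s.
Proof.
apply/seteqP; split => x.
  move=> [q]; rewrite inE => /predU1P[->|qs] xq.
    by left; rewrite /= in_itv.
  by right; exists q.
move=> [|[q qs xq]].
  by rewrite /= in_itv => xq; exists p; rewrite ?mem_head.
by exists q => //; rewrite inE qs orbT.
Qed.

Lemma measurable_chain_set s : measurable (chain_set s).
Proof.
elim: s => [|p s IH]; last by rewrite chain_set_cons; exact: measurableU.
rewrite (_ : chain_set [::] = set0)//; apply/seteqP; split => // x [q].
by rewrite in_nil.
Qed.

(** Serves twice: with [G] the identity it computes the length of a chain, with [G] the monotone
    function its increment. *)
Lemma lebesgue_stieltjes_chain_set G (lo hi : R) s : chain lo hi s ->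
  lebesgue_stieltjes_measure G (chain_set s) =
    (\sum_(p <- s) (G p.2 - G p.1))%:E.
Proof.
elim: s lo => [|p s IH] lo /=.
  rewrite big_nil (_ : chain_set [::] = set0) ?measure0//.
  by apply/seteqP; split => // x [q]; rewrite in_nil.
move=> /and3P[_ p12 cs]; rewrite chain_set_cons big_cons EFinD -(IH _ cs).
rewrite -(lebesgue_stieltjes_itvoc G p12); apply: measureU => //.
  exact: measurable_chain_set.
apply/seteqP; split => // x [/=]; rewrite in_itv/=.
move=> /andP[_ xp] [q qs /andP[qx _]].
have [pq _ _] := chain_mem cs qs.
by move: (le_lt_trans pq qx); rewrite ltNge xp.
Qed.

Lemma chain_grid (p : nat -> R) (P : pred nat) i m :
  {homo p : j k / (j <= k)%N >-> j <= k} ->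
  chain (p i) (p (i + m)%N) [seq (p k, p k.+1) | k <- iota i m & P k].
Proof.
move=> pnd; elim: m i => [|m IH] i /=; first by rewrite addn0.
have := IH i.+1; rewrite addSnnS => h.
case: ifP => _ /=; first by rewrite lexx pnd.
by apply: chain_widen h; [exact: pnd|].
Qed.

Lemma chain_setP p (P : pred nat) m x :
  chain_set [seq (p k, p k.+1) | k <- iota 0 m & P k] x <->
  exists k, [/\ (k < m)%N, P k & p k < x <= p k.+1].
Proof.
split => [[q /mapP[k + ->] /= xq]|[k [km Pk xk]]].
  by rewrite mem_filter mem_iota/= => /andP[Pk km]; exists k.
exists (p k, p k.+1) => //; apply/mapP; exists k => //.
by rewrite mem_filter mem_iota Pk.
Qed.

End ChainMeasure.

(** * Uniform grids filling an open set *)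

Section Grid.
Context {R : realType} (a b : R).
Hypothesis ab : a < b.

Definition grid (n k : nat) : R := a + k%:R * ((b - a) / n.+1%:R).

Lemma grid_step n : 0 < (b - a) / n.+1%:R.
Proof. by rewrite divr_gt0 ?subr_gt0. Qed.

Lemma grid0 n : grid n 0 = a. Proof. by rewrite /grid mul0r addr0. Qed.

Lemma gridn n : grid n n.+1 = b.
Proof. by rewrite /grid mulrC divfK// addrC subrK. Qed.

Lemma grid_nd n : {homo grid n : j k / (j <= k)%N >-> j <= k}.
Proof.
by move=> j k jk; rewrite lerD2l ler_wpM2r ?ler_nat// ltW// grid_step.
Qed.

Definition grid_chain (U : set R) n : seq (R * R) :=
  [seq (grid n k, grid n k.+1) | k <- iota 0 n.+1 &
    `[< `]grid n k, grid n k.+1] `<=` U >] ].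

Lemma chain_grid_chain U n : chain a b (grid_chain U n).
Proof.
have := chain_grid (fun k => `[< `]grid n k, grid n k.+1] `<=` U >]) 0 n.+1
  (grid_nd n).
by rewrite add0n grid0 gridn.
Qed.

Lemma grid_chain_sub U n : chain_set (grid_chain U n) `<=` U.
Proof.
by move=> x /chain_setP[k [_ /asboolP kU xk]]; apply: kU; rewrite /= in_itv.
Qed.

(** Some ball around [x] lies in [U], and the cell containing [x] lies in that ball once the mesh is
    smaller than the radius. *)
Lemma grid_chain_near U x : open U -> U x -> a < x <= b ->
  \forall n \near \oo, chain_set (grid_chain U n) x.
Proof.
move=> oU Ux /andP[ax xb].
have /nbhs_ballP[e /= e0 eU] : nbhs x U by exact: open_nbhs_nbhs.
have : \forall n \near \oo, (b - a) / n.+1%:R < e.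
  near=> n; rewrite ltr_pdivrMr// mulrC -ltr_pdivrMr//.
  apply: lt_trans (_ : n%:R < _); last by rewrite ltr_nat.
  by near: n; exact: nbhs_infty_gtr.
apply: filterS => n ne; apply/chain_setP.
(* The first grid point not below [x] is the right end of its cell; [a < x] excludes index 0. *)
have ex : exists j, x <= grid n j by exists n.+1; rewrite gridn.
case: (ex_minnP ex) => -[|k] xk kmin; first by move: xk; rewrite grid0 leNgt ax.
have kx : grid n k < x by rewrite ltNge; apply/negP => /kmin; rewrite ltnn.
exists k; split; rewrite ?kx//; first by apply: kmin; rewrite gridn.
apply/asboolP => y /=; rewrite in_itv/= => /andP[ky yk]; apply: eU.
rewrite /ball/= ltr_norml.
have : grid n k.+1 = grid n k + (b - a) / n.+1%:R by rewrite /grid -natr1; ring.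
move: ne; set h := (b - a) / _ => ne gk.
by move: xk yk; rewrite gk => xk yk; apply/andP; split; lra.
Unshelve. all: by end_near. Qed.

End Grid.

Section MonotoneDensity.
Context {R : realType} (a b : R) (H : R -> R).
Hypothesis ab : a < b.
Hypothesis aH : ac_on a b H.
Hypothesis ndH : forall x y, a <= x -> x <= y -> y <= b -> H x <= H y.

(** The extension of [H] by constants outside [[a, b]], because a cumulative function must be
    monotone and right-continuous on the whole line. *)
Definition clamped (x : R) : R := H (clamp a b x).

Lemma clamped_nd : {homo clamped : x y / x <= y}.
Proof.
by move=> x y xy; apply: ndH; rewrite ?clamp_ge ?clamp_le ?clamp_nd// ltW.
Qed.

Lemma clamp_lip (x y : R) : x <= y -> clamp a b y - clamp a b x <= y - x.
Proof.
rewrite /clamp => xy; have := ltW ab.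
case: (leP b x); case: (leP b y); case: (leP a b); case: (leP a x);
  case: (leP a y); lra.
Qed.

Lemma clamped_right_continuous (x : R) : clamped @ x^'+ --> clamped x.
Proof.
apply/cvgrPdist_lt => e /aH[d d0 h].
near=> y.
have xy : x < y by near: y; exact: nbhs_right_gt.
rewrite distrC; have := h [:: (clamp a b x, clamp a b y)].
rewrite /var /len !big_seq1 /=; apply.
  by rewrite clamp_ge clamp_nd ?(ltW xy)//= clamp_le// ltW.
apply: le_lt_trans (clamp_lip (ltW xy)) _; rewrite ltrBlDl.
by near: y; apply: nbhs_right_lt; rewrite ltrDl.
Unshelve. all: by end_near. Qed.

HB.instance Definition _ :=
  isCumulative.Build R _ R clamped clamped_nd clamped_right_continuous.

Let LS := lebesgue_stieltjes_measure clamped.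

Let LSfin : (LS `]a, b] < +oo)%E.
Proof. by rewrite /LS lebesgue_stieltjes_itvoc ?ltW// ltry. Qed.

Let mab : measurable (`]a, b]%classic : set (measurableTypeR R)).
Proof. exact: measurable_itv. Qed.

(** The restriction to []a, b]] is a finite measure, to which Radon-Nikodym is applied. *)
Let nu := mfrestr mab LSfin.

(* A null set lies in an open U of small Lebesgue measure; every point of U in
   ]a, b] is eventually in the union of the grid cells contained in U, and those
   cells form a chain of small length, on which H has small variation. *)
Lemma lebesgue_stieltjes_clamped_dominated :
  nu `<< (@lebesgue_measure R).
Proof.
apply/null_content_dominatesP => A mA A0; apply/eqP.
rewrite eq_le measure_ge0 andbT; apply/lee_addgt0Pr => e e0; rewrite add0e.
have [d d0 h] := aH e0.
have [U [oU AU UA]] : exists U : set R, [/\ open U , A `<=` U &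
    (@lebesgue_measure R) (U `\` A) < d%:E]%E.
  by apply: lebesgue_regularity_outer => //; rewrite A0 ltry.
have mU : measurable (U : set (measurableTypeR R)) by exact: open_measurable.
have Ud : ((@lebesgue_measure R) U < d%:E)%E.
  rewrite -(setDUK AU) measureU ?setDIK//; last exact: measurableD.
  by rewrite A0 add0e.
pose E n := chain_set (grid_chain a b U n).
have mE n : measurable (E n) by exact: measurable_chain_set.
have LE n : (LS (E n) <= e%:E)%E.
  have ch := chain_grid_chain ab U n.
  rewrite /LS /E (lebesgue_stieltjes_chain_set _ ch) lee_fin ltW//.
  apply: le_lt_trans (h _ ch _).
    rewrite /var big_seq [leRHS]big_seq ler_sum//.
    move=> p /(chain_mem ch)[p1 p2 p3].
    rewrite /= /clamped !clamp_id ?p1 ?p3 ?(le_trans p1 p2) ?(le_trans p2 p3)//.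
    exact: ler_norm.
  rewrite -lte_fin; apply: le_lt_trans Ud.
  rewrite /len -(lebesgue_stieltjes_chain_set idfun ch).
  apply: le_measure; rewrite ?inE//; first exact: measurable_chain_set.
  exact: grid_chain_sub.
(* The sets [E n] need not increase with [n]. The sets [B n] do, they lie in [E n], and their union
   still covers the part of [A] in []a, b]]; continuity from below then carries the bound [e] over
   to the union. *)
pose B n := \bigcap_(m in [set m | (n <= m)%N]) E m.
have mB n : measurable (B n) by apply: bigcap_measurable => //; exists n => /=.
have ndB : nondecreasing_seq B.
  move=> n m nm; apply/subsetPset => x Bx k /= mk; apply: Bx.
  exact: leq_trans mk.
have mUB : measurable (\bigcup_n B n) by exact: bigcup_measurable.
apply: (@le_trans _ _ (LS (\bigcup_n B n))).
  apply: le_measure; rewrite ?inE//=; first exact: measurableI.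
  move=> x [Ax]; rewrite /= in_itv/= => xab.
  have [N _ HN] := grid_chain_near oU (AU _ Ax) xab.
  by exists N => // m /= Nm; exact: HN.
have cv : LS \o B @ \oo --> LS (\bigcup_n B n) by exact: nondecreasing_cvg_mu.
have <- : limn (LS \o B) = LS (\bigcup_n B n) by exact/cvg_lim.
apply: lime_le; first by apply/cvg_ex; eexists; exact: cv.
apply: nearW => n /=; apply: le_trans (LE n).
by apply: le_measure; rewrite ?inE// => x; apply => /=.
Qed.

(** The Radon-Nikodym derivative of [nu] serves as density, since [nu] gives []a, x]] the mass
    [H x - H a]. It is finite everywhere, so [fine] loses nothing. *)
Lemma monotone_density : exists2 g : R -> R,
  (@lebesgue_measure R).-integrable setT (EFin \o g) &
  forall x, a <= x <= b ->
    H x - H a = \int[@lebesgue_measure R]_(t in `]a, x]) g t.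
Proof.
have dom := lebesgue_stieltjes_clamped_dominated.
pose f := Radon_Nikodym_SigmaFinite.f nu (@lebesgue_measure R).
have fE : EFin \o (fine \o f) = f.
  by apply/funext => x /=; rewrite fineK// Radon_Nikodym_SigmaFinite.f_fin_num.
exists (fine \o f).
  by rewrite fE; exact: Radon_Nikodym_SigmaFinite.f_integrable.
move=> x /andP[ax xb].
rewrite /Rintegral -[X in integral _ _ X]/(EFin \o (fine \o f)) fE.
rewrite -Radon_Nikodym_SigmaFinite.f_integral//.
rewrite [X in fine X](_ : _ = LS `]a, x]); last first.
  congr (LS _); apply/setIidl => y /=; rewrite !in_itv/= => /andP[-> yx].
  exact: le_trans xb.
rewrite /LS lebesgue_stieltjes_itvoc//= /clamped !clamp_id ?lexx ?ax ?xb//.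
exact: ltW.
Qed.

End MonotoneDensity.

(** * The fundamental theorem of calculus *)

Section AbsolutelyContinuousFTC.
Context {R : realType}.
Implicit Types (a b x : R) (F G g : R -> R).
Local Notation mu := (@lebesgue_measure R).

Lemma ac_on_density a b F : a < b -> ac_on a b F -> exists2 g : R -> R,
  mu.-integrable setT (EFin \o g) &
  forall x, a <= x <= b -> F x - F a = \int[mu]_(t in `]a, x]) g t.
Proof.
move=> ab aF; have aT := ac_on_totvar (ltW ab) aF.
have [g1 i1 h1] := monotone_density ab aT
  (fun x y ax xy yb => (totvar_nd (ltW ab) aF ax xy yb).1).
have [g2 i2 h2] := monotone_density ab (ac_onB aT aF)
  (fun x y ax xy yb => (totvar_nd (ltW ab) aF ax xy yb).2).
exists (g1 \- g2).
  rewrite (_ : _ \o _ = (EFin \o g1) \- (EFin \o g2))%E//.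
  exact: integrableB.
move=> x axb; rewrite RintegralB//; first by rewrite -h1// -h2//; ring.
  exact: integrableS i1.
exact: integrableS i2.
Qed.

(** Lebesgue differentiation, in the form [FTC1], gives the derivative of the indefinite integral
    almost everywhere. *)
Lemma ac_on_is_derive_density a b F g : a < b ->
  mu.-integrable setT (EFin \o g) ->
  (forall x, a <= x <= b -> F x - F a = \int[mu]_(t in `]a, x]) g t) ->
  {ae mu, forall x, a < x < b -> is_derive x 1 F (g x)}.
Proof.
move=> ab ig Fg.
have ig' y : mu.-integrable `]a, y] (EFin \o g) by exact: integrableS ig.
have := FTC1 ig' (open_integrable_locally openT ig).
apply: filterS; first exact: (ae_filter_ringOfSetsType mu).
move=> x h /andP[ax xb].
have [|/derivableP d e] := h; first by [].
rewrite -e derive1E.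
have dc : is_derive x 1 (cst (F a)) 0 by exact: is_derive_cst.
have := is_deriveD dc d; rewrite add0r.
(* The integral formula for [F] holds only on [[a, b]], which contains a neighbourhood of the
   interior point [x]. *)
apply: near_eq_is_derive; near=> y => /=.
transitivity (F a + \int[mu]_(t in `]a, y]) g t) => //.
rewrite -Fg; first by rewrite addrC subrK.
apply/andP; split; apply: ltW; near: y.
  exact: lt_nbhsr.
exact: lt_nbhsl.
Unshelve. all: by end_near. Qed.

Lemma ac_on_derivable_ae a b F : a < b -> ac_on a b F ->
  {ae mu, forall x, a < x < b -> derivable F x 1}.
Proof.
move=> ab aF; have [g ig Fg] := ac_on_density ab aF.
have := ac_on_is_derive_density ab ig Fg.
apply: filterS; first exact: (ae_filter_ringOfSetsType mu).
move=> x h /h xab.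
exact: ex_derive.
Qed.

(** * Transfer of integrals from the Borel sets to the completed Lebesgue measure *)

Lemma leb_measurable (D : set R) : measurable (D : set (measurableTypeR R)) ->
  measurable (D : set (lebT R)).
Proof. exact: sub_caratheodory. Qed.

(* The identity, measurable from Lebesgue-measurable to Borel sets; it pushes
   [leb] forward to [lebesgue_measure]. *)
Definition of_leb (x : lebT R) : measurableTypeR R := x.

Lemma measurable_of_leb : measurable_fun setT of_leb.
Proof. by move=> _ B mB; rewrite setTI; exact: leb_measurable. Qed.

Lemma ge0_integral_leb (D : set R) (f : R -> \bar R) :
  measurable (D : set (measurableTypeR R)) ->
  @measurable_fun _ _ (measurableTypeR R) _ D f ->
  (forall x, D x -> 0 <= f x)%E ->
  (\int[@leb R]_(x in D) f x = \int[mu]_(x in D) f x)%E.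
Proof.
move=> mD mf f0.
have := ge0_integral_pushforward measurable_of_leb (@leb R) mD mf.
move=> e.
rewrite -[LHS]/(\int[@leb R]_(x in of_leb @^-1` D) (f \o of_leb) x)%E -e.
  by apply: eq_measure_integral => // B mB; exact: measurable_of_leb.
by move=> x; rewrite inE; exact: f0.
Qed.

Lemma integrable_leb (D : set R) (f : R -> \bar R) :
  measurable (D : set (measurableTypeR R)) -> mu.-integrable D f ->
  (@leb R).-integrable D f /\
  (\int[@leb R]_(x in D) f x = \int[mu]_(x in D) f x)%E.
Proof.
move=> mD /[dup] intf /integrableP[mf foo]; split.
  apply/integrableP; split; last first.
    rewrite ge0_integral_leb//; exact: measurableT_comp.
  by move=> _ B mB; apply: leb_measurable; exact: mf.
rewrite [LHS]integralE [RHS]integralE !ge0_integral_leb//.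
  exact: measurable_funeneg.
exact: measurable_funepos.
Qed.

(** The density of [F] and the function [G] are both almost everywhere the derivative of [F], so
    they agree off a null set. As [G] is arbitrary on that set, its measurability rests on the
    completeness of [leb]. *)
Lemma ac_on_ftc a b F G : a < b -> ac_on a b F ->
  {ae mu, forall x, a < x < b -> is_derive x 1 F (G x)} ->
  (@leb R).-integrable `[a, b] (EFin \o G) /\
  \int[@leb R]_(t in `[a, b]) G t = F b - F a.
Proof.
move=> ab aF FG; have [g ig Fg] := ac_on_density ab aF.
have gF := ac_on_is_derive_density ab ig Fg.
have mab : measurable (`[a, b]%classic : set (measurableTypeR R)).
  exact: measurable_itv.
have ig' : mu.-integrable `[a, b] (EFin \o g) by exact: integrableS ig.
have [il El] := integrable_leb mab ig'.
have gG : ae_eq (@leb R) `[a, b]%classic (EFin \o g)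
    (EFin \o (G : lebT R -> R)).
  have [N [mN N0 NP]] : {ae mu, forall x, a < x < b -> g x = G x}.
    apply: filterS2 gF FG; first exact: (ae_filter_ringOfSetsType mu).
    move=> x h1 h2 xab; rewrite -(@derive_val _ _ _ _ _ _ _ (h1 xab)).
    by rewrite (@derive_val _ _ _ _ _ _ _ (h2 xab)).
  (* The endpoints join the exceptional set because the derivatives are compared only in the
     interior. *)
  exists (N `|` [set a; b]); split.
  - by apply: leb_measurable; apply: measurableU => //; exact: measurableU.
  - change (mu (N `|` [set a; b]) = 0%E).
    rewrite measureU0//; last first.
      by rewrite measureU0//; exact: lebesgue_measure_set1.
    exact: measurableU.
  - move=> x /= /not_implyP[]; rewrite in_itv/= => /andP[ax xb] gGx.
    have [->|xa] := eqVneq x a; first by right; left.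
    have [->|xb'] := eqVneq x b; first by right; right.
    left; apply: NP => /= h; apply: gGx; rewrite h//.
    by rewrite !lt_neqAle ax xb xb' eq_sym xa.
have mabl := leb_measurable mab.
have mG : @measurable_fun _ _ (lebT R) _ `[a, b]%classic (EFin \o G).
  apply: (ae_measurable_fun (@completed_lebesgue_measure_is_complete R) gG).
  exact: measurable_int il.
have iG : (\int[@leb R]_(t in `[a, b]) (EFin \o G) t =
    \int[@leb R]_(t in `[a, b]) (EFin \o g) t)%E.
  apply: ae_eq_integral => //; first exact: measurable_int il.
  exact: ae_eq_sym.
split.
  apply/integrableP; split => //.
  suff <- : (\int[@leb R]_(t in `[a, b]) `|(EFin \o g) t| =
      \int[@leb R]_(t in `[a, b]) `|(EFin \o G) t|)%E by case/integrableP : il.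
  apply: ge0_ae_eq_integral.
  - exact: mabl.
  - by apply: measurableT_comp => //; exact: measurable_int il.
  - exact: measurableT_comp.
  - by move=> t _; exact: abse_ge0.
  - by move=> t _; exact: abse_ge0.
  - exact: ae_eq_abse.
rewrite /Rintegral -[X in integral _ _ X]/(EFin \o G) iG El.
rewrite (Fg b) ?lexx ?ltW// Rintegral_itv_obnd_cbnd//.
exact: integrableS ig.
Qed.

End AbsolutelyContinuousFTC.

(** * Boundedness, continuity and algebra of absolutely continuous functions *)

Section AbsolutelyContinuousAlgebra.
Context {R : realType}.
Implicit Types (a b x y : R) (F G : R -> R).

Lemma ac_on_bounded a b F : a <= b -> ac_on a b F ->
  exists2 M, 0 < M & forall x, a <= x <= b -> `|F x| <= M.
Proof.
move=> ab aF; have [M hM] := ac_on_var_bounded ab aF.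
exists (`|F a| + `|M| + 1); first by rewrite ltr_wpDl// addr_ge0.
move=> x /andP[ax xb].
have := hM [:: (a, x)]; rewrite /= lexx ax xb => /(_ isT).
rewrite /var big_seq1/= => h.
have := ler_normD (F a) (F x - F a); rewrite addrC subrK.
by have := ler_norm M; lra.
Qed.

Lemma ac_onM a b F G : a <= b -> ac_on a b F -> ac_on a b G ->
  ac_on a b (fun x => F x * G x).
Proof.
move=> ab aF aG; have [M M0 hM] := ac_on_bounded ab aF.
have [N N0 hN] := ac_on_bounded ab aG.
apply: (@ac_on_dominated _ _ _ F G _ (M + N)) => // x y hx hy.
have -> : F y * G y - F x * G x = F y * (G y - G x) + G x * (F y - F x) by ring.
apply: le_trans (ler_normD _ _) _; rewrite !normrM mulrDr addrC.
apply: lerD; apply: ler_wpM2r => //.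
  by apply: le_trans (hN _ hx) _; rewrite lerDr ltW.
by apply: le_trans (hM _ hy) _; rewrite lerDl ltW.
Qed.

Lemma ac_onD a b F G : ac_on a b F -> ac_on a b G -> ac_on a b (fun x => F x + G x).
Proof.
apply: (@ac_on_dominated _ _ _ _ _ _ 1) => x y _ _; rewrite mul1r.
have -> : F y + G y - (F x + G x) = (F y - F x) + (G y - G x) by ring.
exact: ler_normD.
Qed.

Lemma ac_on_cst a b (c : R) : ac_on a b (fun=> c).
Proof.
apply: (@ac_on_dominated _ _ _ id id _ 0); try exact: ac_on_id.
by move=> x y _ _; rewrite mul0r subrr normr0.
Qed.

Lemma ac_on_continuous a b F : ac_on a b F -> {within `[a, b], continuous F}.
Proof.
move=> aF; apply/subspace_continuousP => x /=; rewrite in_itv/= => /andP[ax xb].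
apply/cvgrPdist_lt => e /aF[d d0 h].
apply/nbhs_ballP; exists d => //= y; rewrite /ball/= in_itv/=.
move=> xyd /andP[ay yb].
have [xy|/ltW yx] := leP x y.
  rewrite distrC; have := h [:: (x, y)]; rewrite /= ax xy yb => /(_ isT).
  rewrite /len /var !big_seq1/=; apply.
  by rewrite distrC ger0_norm ?subr_ge0 in xyd.
have := h [:: (y, x)]; rewrite /= ay yx xb => /(_ isT).
by rewrite /len /var !big_seq1/=; apply; rewrite ger0_norm ?subr_ge0 in xyd.
Qed.

(** The continuous function [|F|] attains a positive minimum [|F c|] on [[a, b]], so increments of
    the reciprocal are at most those of [F] divided by [|F c|^2]. *)
Lemma ac_onV a b F : a <= b -> ac_on a b F -> (forall x, a <= x <= b -> F x != 0) ->
  ac_on a b (fun x => (F x)^-1).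
Proof.
move=> ab aF F0.
have aA : ac_on a b (fun x => `|F x|).
  apply: (@ac_on_dominated _ _ _ F F _ 1) => // x y _ _; rewrite mul1r.
  by apply: le_trans (ler_dist_dist _ _) _; rewrite lerDl.
have [c cab hc] := EVT_min ab (ac_on_continuous aA).
have c0 : 0 < `|F c| by rewrite normr_gt0 F0//; move: cab; rewrite in_itv.
have Vle z : a <= z <= b -> `|(F z)^-1| <= `|F c|^-1.
  move=> hz; rewrite normfV lef_pV2 ?posrE// ?normr_gt0 ?F0//.
  by apply: hc; rewrite in_itv.
apply: (@ac_on_dominated _ _ _ F F _ (`|F c| ^- 2)) => // x y hx hy.
have [Fx Fy] := (F0 _ hx, F0 _ hy).
have -> : (F y)^-1 - (F x)^-1 = (F x)^-1 * (F y)^-1 * - (F y - F x).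
  by field; rewrite Fx Fy.
rewrite normrM normrN; apply: ler_pM => //; last by rewrite lerDl.
by rewrite normrM -exprVn expr2 ler_pM ?Vle.
Qed.

End AbsolutelyContinuousAlgebra.

(** * Derivatives relative to a set *)

Section DerivOn.
Context {R : realType}.
Implicit Types (A : set R) (f df : R -> R).

Lemma deriv_on_is_derive A f df x : nbhs x A -> deriv_on A f df -> A x ->
  is_derive x 1 f (df x).
Proof.
move=> nA /[apply] dfx.
have h :
    (fun h : R => h^-1 *: ((f \o shift x) (h *: (1 : R)) - f x)) @ 0^' --> df x.
  apply/cvgrPdist_lt => e e0.
  have /cvgrPdist_lt/(_ e e0) := dfx.
  have : \forall h \near 0^', A (x + h).
    have /nbhs_ballP[d /= d0 dA] := nA.
    apply/nbhs_ballP; exists d => //= h; rewrite /ball/= sub0r normrN => hd _.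
    by apply: dA; rewrite /ball/= opprD addrA subrr sub0r normrN.
  apply: filterS2 => h Ah /(_ Ah).
  by rewrite /= /GRing.scale /= mulr1 [h + x]addrC.
by apply: DeriveDef; [apply/cvg_ex; exists (df x)|exact/cvg_lim].
Qed.

(** Near [x] within [A] the difference quotients are bounded by [|df x| + 1]. *)
Lemma deriv_on_continuous A f df : deriv_on A f df -> {within A, continuous f}.
Proof.
move=> fA; apply/subspace_continuousP => x Ax.
have /cvgrPdist_lt/(_ 1 ltr01) := fA x Ax.
move=> /nbhs_ballP[d /= d0 hd].
apply/cvgrPdist_lt => e e0.
pose M := `|df x| + 1.
have M0 : 0 < M by rewrite ltr_wpDl.
apply/nbhs_ballP; exists (Num.min d (e / M)) => /=.
  by rewrite lt_min d0 divr_gt0.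
move=> y; rewrite /ball/= lt_min => /andP[xyd xye] Ay.
have [->|yx] := eqVneq y x; first by rewrite subrr normr0.
have := hd (y - x); rewrite /ball/= sub0r normrN distrC => /(_ xyd).
rewrite subr_eq0 addrC subrK => /(_ yx Ay).
set q := _^-1 * _ => hq.
have qM : `|q| < M.
  by have := ler_normB (df x) (df x - q); rewrite opprB addrC subrK /M; lra.
have -> : f x - f y = q * (x - y).
  by rewrite /q; field; rewrite subr_eq0.
rewrite normrM; apply: (@le_lt_trans _ _ (M * `|x - y|)).
  by rewrite ler_wpM2r// ltW.
by rewrite mulrC -ltr_pdivlMr.
Qed.

(** By the mean value theorem [f] is Lipschitz with constant [M]. *)
Lemma bounded_derive_ac_on (a b M : R) f df : a < b ->
  (forall x, a < x < b -> is_derive x 1 f (df x)) ->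
  {within `[a, b], continuous f} ->
  (forall x, a <= x <= b -> `|df x| <= M) -> ac_on a b f.
Proof.
move=> ab fd fc dM.
suff L : forall x y, a <= x -> x <= y -> y <= b -> `|f y - f x| <= M * `|y - x|.
  have M0 : 0 <= M.
    by apply: le_trans (normr_ge0 (df a)) (dM a _); rewrite lexx ltW.
  apply: (@ac_on_dominated _ _ _ id id _ M); try exact: ac_on_id.
  move=> x y hx hy.
  have [/andP[ax xb] /andP[ay yb]] := (hx, hy).
  apply: (@le_trans _ _ (M * `|y - x|)); last by rewrite ler_wpM2l// lerDl.
  have [xy|/ltW yx] := leP x y; first exact: L.
  by rewrite distrC [`|y - x|]distrC L.
move=> x y ax xy yb.
have [z zxy ->] : exists2 c, c \in `[x, y] & f y - f x = df c * (y - x).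
  apply: MVT_segment => // [z|].
    rewrite in_itv/= => /andP[xz zy]; apply: fd.
    by rewrite (le_lt_trans ax xz) (lt_le_trans zy yb).
  apply: continuous_subspaceW fc => z /=; rewrite !in_itv/= => /andP[xz zy].
  by rewrite (le_trans ax xz) (le_trans zy yb).
move: zxy; rewrite in_itv/= => /andP[xz zy].
by rewrite normrM ler_wpM2r// dM// (le_trans ax xz) (le_trans zy yb).
Qed.

End DerivOn.

(** * Improper integrals and Wronskian quotients *)

Section Improper.
Context {R : realType} (T : R) (x0 : \bar R).
Implicit Types (x b l : R) (h G : R -> R).
Local Notation mu := (@lebesgue_measure R).

#[local] Instance to_x0_proper : ProperFilter (to_x0 x0).
Proof. by case: x0 => [r| |] /=; exact: _. Qed.

Lemma near_to_x0 x : (x%:E < x0)%E ->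
  \forall b \near to_x0 x0, x <= b /\ (b%:E < x0)%E.
Proof.
case: x0 => [r| |] //=; rewrite ?lte_fin => xr.
- near=> b; split; first by apply: ltW; near: b; exact: nbhs_left_gt.
  by rewrite lte_fin; near: b; exact: nbhs_left_lt.
- near=> b; split; last by rewrite ltry.
  by near: b; apply: nbhs_pinfty_ge; rewrite num_real.
Unshelve. all: by end_near. Qed.

(** The derivative is asked for only almost everywhere, because [Lop] involves second derivatives
    that exist only almost everywhere. *)
Definition primitive_of h G := forall b, T < b -> (b%:E < x0)%E ->
  ac_on T b h /\ {ae mu, forall x, T < x < b -> is_derive x 1 h (G x)}.

Lemma primitive_integral h G x b :
  primitive_of h G -> T <= x -> x <= b -> (b%:E < x0)%E ->
  (@leb R).-integrable `[x, b] (EFin \o G) /\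
  \int[@leb R]_(t in `[x, b]) G t = h b - h x.
Proof.
(* The case [b = x] is separate because [ac_on_ftc] needs a nondegenerate interval. *)
move=> hG Tx; rewrite le_eqVlt => /predU1P[<-|xb] bx0.
  rewrite set_itv1 subrr.
  have x0' : (@leb R) [set x] = 0%E by exact: lebesgue_measure_set1.
  have mx : measurable ([set x] : set (lebT R)).
    exact: leb_measurable (measurable_set1 _).
  split; first by apply: null_set_integrable => //; exact: measurable_fun_set1.
  rewrite /Rintegral null_set_integral.
  - by [].
  - exact: mx.
  - exact: measurable_fun_set1.
  - exact: x0'.
have [aH hd] := hG b (le_lt_trans Tx xb) bx0.
apply: ac_on_ftc => //; first exact: ac_on_sub aH.
apply: filterS hd; first exact: (ae_filter_ringOfSetsType mu).
move=> y /[swap] /andP[xy yb]; apply.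
by rewrite (le_lt_trans Tx xy).
Qed.

(** The integral over [[x, b]] is [h b - h x], so its limit as [b] tends to [x0] is governed by that
    of [h]. *)
Lemma improper_toP h G x l : primitive_of h G -> Iset T x0 x ->
  improper_to x x0 G l <-> h @ to_x0 x0 --> h x + l.
Proof.
move=> hG [Tx xx0].
have E : \forall b \near to_x0 x0, h b = h x + \int[@leb R]_(t in `[x, b]) G t.
  apply: filterS (near_to_x0 xx0) => b [xb bx0].
  by rewrite (primitive_integral hG Tx xb bx0).2 addrC subrK.
split=> [[_ cG]|ch].
  apply: (cvg_trans _ (cvgD (cvg_cst (h x)) cG)); apply: near_eq_cvg.
  by apply: filterS E => b /= ->.
split; first by move=> b xb bx0; exact: (primitive_integral hG Tx xb bx0).1.
have -> : l = h x + l - h x by rewrite addrAC subrr add0r.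
apply: (cvg_trans _ (cvgB ch (cvg_cst (h x)))); apply: near_eq_cvg.
apply: filterS E => b /= hb.
by rewrite /= [LHS](_ : _ = h b - h x)// hb addrAC subrr add0r.
Qed.

Lemma improper_cvgP h G : (T%:E < x0)%E -> primitive_of h G ->
  improper_cvg T x0 G <-> exists l, h @ to_x0 x0 --> l.
Proof.
move=> Tx0 hG; have IT : Iset T x0 T by split.
split=> [[l /(improper_toP _ hG IT)]|[l hl]]; first by exists (h T + l).
by exists (l - h T); apply/(improper_toP _ hG IT); rewrite addrC subrK.
Qed.

Lemma eq_improper_to x G1 G2 l :
  (forall t, x <= t -> (t%:E < x0)%E -> G1 t = G2 t) ->
  (x%:E < x0)%E -> improper_to x x0 G1 l -> improper_to x x0 G2 l.
Proof.
move=> G12 xx0 [i1 c1].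
have eqD b : (b%:E < x0)%E -> {in `[x, b]%classic, G1 =1 G2}.
  move=> bx0 t; rewrite inE/= in_itv/= => /andP[xt tb]; apply: G12 => //.
  by apply: le_lt_trans bx0; rewrite lee_fin.
split.
  move=> b xb bx0; apply: eq_integrable (i1 b xb bx0).
    exact: leb_measurable (measurable_itv _).
  by move=> t /(eqD b bx0) /= ->.
apply: (cvg_trans _ c1); apply: near_eq_cvg.
apply: filterS (near_to_x0 xx0) => b [_ bx0].
by apply: eq_Rintegral => t /(eqD b bx0) ->.
Qed.

End Improper.

Section WronskianQuotients.
Context {R : realType} (T : R) (x0 : \bar R).
Implicit Types (f df : R -> R) (x b : R).
Local Notation mu := (@lebesgue_measure R).

Lemma nbhs_Iset b x : T < x -> x < b -> (b%:E < x0)%E -> nbhs x (Iset T x0).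
Proof.
move=> Tx xb bx0; near=> y; split.
  by apply: ltW; near: y; exact: lt_nbhsr.
apply: lt_trans bx0; rewrite lte_fin; near: y; exact: lt_nbhsl.
Unshelve. all: by end_near. Qed.

Lemma C1_on_is_derive f df b x :
  C1_on T x0 f df -> T < x -> x < b -> (b%:E < x0)%E ->
  is_derive x 1 f (df x).
Proof.
move=> [fdf _] Tx xb bx0.
apply: deriv_on_is_derive fdf _; first exact: nbhs_Iset bx0.
by split; [exact: ltW|exact: lt_trans bx0].
Qed.

(** Being absolutely continuous, [df] is bounded on [[T, b]], which makes [f] Lipschitz there. *)
Lemma AC1_on_ac_on f df b : AC1_on T x0 f df -> T < b -> (b%:E < x0)%E ->
  ac_on T b f /\ ac_on T b df.
Proof.
move=> [fdf acdf] Tb bx0.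
have adf : ac_on T b df by apply/abs_cont_ac_on/acdf.
split=> //; have [M _ dM] := ac_on_bounded (ltW Tb) adf.
apply: (bounded_derive_ac_on Tb _ _ dM).
  by move=> x /andP[Tx xb]; exact: (C1_on_is_derive fdf Tx xb bx0).
apply: continuous_subspaceW (deriv_on_continuous fdf.1) => x /=.
rewrite in_itv/= => /andP[Tx xb]; split => //.
by apply: le_lt_trans bx0; rewrite lee_fin.
Qed.

Variables (phi1 dphi1 phi2 dphi2 f df : R -> R).
Hypotheses (hphi1 : AC1_on T x0 phi1 dphi1) (hphi2 : AC1_on T x0 phi2 dphi2).
Hypothesis hf : AC1_on T x0 f df.
Let W := Wr phi1 dphi1 phi2 dphi2.
Hypothesis hW : forall x, Iset T x0 x -> W x != 0.

(** With [psi = c1 phi1 + c2 phi2] this is the quotient of the Wronskian of [psi] and [f] by [W].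
    One two-parameter family thus covers all three quotients of the theorem. *)
Let h (c1 c2 : R) t :=
  - ((c1 * Wr f df phi1 dphi1 t + c2 * Wr f df phi2 dphi2 t) / W t).
Let g (c1 c2 : R) t :=
  (c1 * phi1 t + c2 * phi2 t) / W t * Lop phi1 dphi1 phi2 dphi2 f df t.

(** In the derivative of a Wronskian the products of first derivatives cancel, leaving
    [u v'' - u'' v]. The quotient rule then turns the claim into a rational identity, valid where
    [W] does not vanish. *)
Lemma wronskian_quotient_is_derive (c1 c2 x : R) : W x != 0 ->
  is_derive x 1 phi1 (dphi1 x) -> is_derive x 1 phi2 (dphi2 x) ->
  is_derive x 1 f (df x) ->
  derivable dphi1 x 1 -> derivable dphi2 x 1 -> derivable df x 1 ->
  is_derive x 1 (h c1 c2) (g c1 c2 x).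
Proof.
move=> Wx d1 d2 d /derivableP dd1 /derivableP dd2 /derivableP dd.
have WrP u du v dv : is_derive x 1 u (du x) -> is_derive x 1 v (dv x) ->
    is_derive x 1 du ('D_1 du x) -> is_derive x 1 dv ('D_1 dv x) ->
    is_derive x 1 (Wr u du v dv) (u x * 'D_1 dv x - 'D_1 du x * v x).
  move=> du1 dv1 du2 dv2.
  have d12 := is_deriveB (is_deriveM du1 dv2) (is_deriveM du2 dv1).
  apply: (is_derive_eq d12).
  by rewrite /GRing.scale/=; ring.
have dW := WrP _ _ _ _ d1 d2 dd1 dd2.
have dc (c : R) : is_derive x 1 (cst c) 0 by exact: is_derive_cst.
have dn := is_deriveD (is_deriveM (dc c1) (WrP _ _ _ _ d d1 dd dd1))
  (is_deriveM (dc c2) (WrP _ _ _ _ d d2 dd dd2)).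
apply: (is_derive_eq (is_deriveN (is_deriveM dn (is_deriveV Wx dW)))).
rewrite /g /Lop -/(W x) !derive1E /GRing.scale !fctE/=.
by move: Wx; rewrite /W /Wr /= => Wx; field.
Qed.

(** Absolute continuity follows from the algebra above. The three functions [dphi1], [dphi2] and
    [df] are simultaneously differentiable off a union of three null sets. *)
Lemma wronskian_quotient_primitive (c1 c2 : R) :
  primitive_of T x0 (h c1 c2) (g c1 c2).
Proof.
move=> b Tb bx0.
have [a1 ad1] := AC1_on_ac_on hphi1 Tb bx0.
have [a2 ad2] := AC1_on_ac_on hphi2 Tb bx0.
have [a ad] := AC1_on_ac_on hf Tb bx0.
have leTb := ltW Tb.
have WrP u du v dv : ac_on T b u -> ac_on T b du -> ac_on T b v -> ac_on T b dv ->
    ac_on T b (Wr u du v dv).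
  by move=> *; apply: ac_onB; apply: ac_onM.
split.
  have cM c F : ac_on T b F -> ac_on T b (fun x => c * F x).
    by move=> aF; apply: ac_onM => //; exact: ac_on_cst.
  rewrite (_ : h c1 c2 = fun x => -1 * ((c1 * Wr f df phi1 dphi1 x +
      c2 * Wr f df phi2 dphi2 x) * (W x)^-1)); last first.
    by apply/funext => x; rewrite mulN1r.
  apply/cM/ac_onM => //; first by apply: ac_onD; apply/cM/WrP.
  apply: ac_onV => //; first exact: WrP.
  move=> x /andP[Tx xb]; apply: hW; split => //.
  by apply: le_lt_trans bx0; rewrite lee_fin.
apply: (filterS3 _ _ (ac_on_derivable_ae Tb ad1) (ac_on_derivable_ae Tb ad2)
  (ac_on_derivable_ae Tb ad)).
  exact: (ae_filter_ringOfSetsType mu).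
move=> x D1 D2 D /[dup] Txb /andP[Tx xb].
apply: wronskian_quotient_is_derive; [| | | |exact: D1|exact: D2|exact: D].
- by apply: hW; split; [exact: ltW|exact: lt_trans bx0].
- exact: (C1_on_is_derive hphi1.1 Tx xb bx0).
- exact: (C1_on_is_derive hphi2.1 Tx xb bx0).
- exact: (C1_on_is_derive hf.1 Tx xb bx0).
Qed.

End WronskianQuotients.

Theorem theorem5p2 (R : realType) (x0 : \bar R) (T : R)
    (phi1 dphi1 phi2 dphi2 f df : R -> R)
    (hT : (T%:E < x0)%E)
    (hphi1 : AC1_on T x0 phi1 dphi1)
    (hphi2 : AC1_on T x0 phi2 dphi2)
    (ho : (fun x => phi2 x / phi1 x) @ to_x0 x0 --> (0:R))
    (hnz1 : forall x, Iset T x0 x -> phi1 x != 0)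
    (hnz2 : forall x, Iset T x0 x -> phi2 x != 0)
    (hW : forall x, Iset T x0 x -> Wr phi1 dphi1 phi2 dphi2 x != 0)
    (hf : AC1_on T x0 f df) :
  let W := Wr phi1 dphi1 phi2 dphi2 in
  let Lf := Lop phi1 dphi1 phi2 dphi2 f df in
  let f1s := fun t => Wr f df phi2 dphi2 t / W t in
  let f2s := fun t => - (Wr f df phi1 dphi1 t / W t) in
  let Phi := fun t => phi2 T * phi1 t - phi1 T * phi2 t in
  let Fs := fun t => phi1 T * f1s t + phi2 T * f2s t in
  let g1 := fun t => phi2 t / W t * Lf t in
  let g2 := fun t => phi1 t / W t * Lf t in
  let gPhi := fun t => Phi t / W t * Lf t in
  (* (phi1/phi2)' *)
  let dq := fun t => (dphi1 t * phi2 t - phi1 t * dphi2 t) / (phi2 t ^+ 2) in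
  (* (I) *)
  ((exists a1 : R, f1s @ to_x0 x0 --> a1) <-> improper_cvg T x0 g1) /\
  (forall a1 : R, f1s @ to_x0 x0 --> a1 ->
     forall x, Iset T x0 x -> improper_to x x0 g1 (f1s x - a1)) /\
  ((exists a1 : R, f1s @ to_x0 x0 --> a1 /\
       improper_cvg T x0 (fun t => dq t * (f1s t - a1))) <->
   (exists G : R -> R, (forall t, Iset T x0 t -> improper_to t x0 g1 (G t)) /\
       improper_cvg T x0 (fun t => dq t * G t))) /\
  (* (II) *)
  ((exists a2 : R, f2s @ to_x0 x0 --> a2) <-> improper_cvg T x0 g2) /\
  (forall a2 : R, f2s @ to_x0 x0 --> a2 ->
     forall x, Iset T x0 x -> improper_to x x0 g2 (a2 - f2s x)) /\
  ((exists gamma : R, Fs @ to_x0 x0 --> gamma) <-> improper_cvg T x0 gPhi) /\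
  (forall gamma : R, Fs @ to_x0 x0 --> gamma ->
     forall x, Iset T x0 x -> improper_to x x0 gPhi (gamma - Fs x)).
Proof.
move=> W Lf f1s f2s Phi Fs g1 g2 gPhi dq.
have to_x0_filter := to_x0_proper x0.
(* The coefficients [(0, 1)], [(1, 0)] and [(phi2 T, - phi1 T)] yield [- f1s], [f2s] and [Fs]. The
   sign on [f1s] explains why its tail integral enters with the opposite sign. *)
have P c1 c2 := wronskian_quotient_primitive hphi1 hphi2 hf hW c1 c2.
have P1 : primitive_of T x0 (fun t => - f1s t) g1.
  move: (P 0 1); congr primitive_of; apply/funext => t; rewrite /f1s /g1.
    by rewrite mul0r add0r mul1r.
  by rewrite mul0r add0r mul1r.
have P2 : primitive_of T x0 f2s g2.
  move: (P 1 0); congr primitive_of; apply/funext => t; rewrite /f2s /g2.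
    by rewrite mul0r addr0 mul1r.
  by rewrite mul0r addr0 mul1r.
have PF : primitive_of T x0 Fs gPhi.
  move: (P (phi2 T) (- phi1 T)); congr primitive_of; apply/funext => t.
    by rewrite /Fs /f1s /f2s -/W; ring.
  by rewrite /gPhi /Phi mulNr.
have IT : Iset T x0 T by split.
have f1N (a : R) :
    f1s @ to_x0 x0 --> a <-> (fun t => - f1s t) @ to_x0 x0 --> - a.
  split=> [|h]; first by move=> h; exact: (cvgN h).
  by rewrite -[f1s]opprK -[a]opprK; exact: (cvgN h).
have f1improper a1 x : f1s @ to_x0 x0 --> a1 -> Iset T x0 x ->
    improper_to x x0 g1 (f1s x - a1).
  move=> /f1N fa Ix; apply/(improper_toP _ P1 Ix).
  by rewrite addrA addNr add0r.
split; [|split; [|split; [|split; [|split; [|split]]]]].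
- rewrite (improper_cvgP hT P1); split=> -[a ha].
    by exists (- a); apply/f1N.
  by exists (- a); apply/f1N; rewrite opprK.
- by move=> a1 ha x Ix; exact: f1improper.
- split=> [[a1 [ha hdq]]|[G [hG [l hdq]]]].
    by exists (fun t => f1s t - a1); split => // t It; exact: f1improper.
  (* Convergence of the inner integral at [t = T] alone forces [f1s] to converge, namely to
     [f1s T - G T]. *)
  have /(improper_toP _ P1 IT) := hG T IT.
  rewrite -[X in _ --> X]opprK => /f1N; set a1 := - _ => ha.
  exists a1; split => //; exists l.
  apply: (eq_improper_to _ hT hdq) => t Tt tx0; congr (_ * _).
  have It : Iset T x0 t by split.
  (* Both [G t] and [f1s t - a1] are limits of the same integrals, so the two outer integrands
     coincide on the interval. *)
  have [_ c1] := hG t It; have [_ c2] := f1improper _ _ ha It.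
  exact: cvg_unique c1 c2.
- exact: iff_sym (improper_cvgP hT P2).
- move=> a2 ha x Ix; apply/(improper_toP _ P2 Ix).
  by rewrite addrC subrK.
- exact: iff_sym (improper_cvgP hT PF).
- move=> c hc x Ix; apply/(improper_toP _ PF Ix).
  by rewrite addrC subrK.
Qed.
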